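(* Let $G=(V,E)$ be a locally finite weighted graph satisfying the $CD\psi(n,-K)$ condition with $K\geq0$, where $\psi\in C^1(0,+\infty)$ is a concave function. Let $T>0$ and assume that $W\in C^1[0,T)\cap C[0,T]$ satisfies $W(0)=1$, $W(T)=0$, $W>0$ on $[0,T)$ and $W'\in L^2(0,T)$. Then for any $f\in\ell^\infty(V)$ with $f>0$ everywhere, pointwise on $V$, $$\Gamma^\psi(P_Tf)\leq\psi'(1)\left(1+2K\int_0^TW(s)^2\,ds\right)\frac{\Delta P_Tf}{P_Tf}+\frac n2\left(\int_0^TW'(s)^2\,ds+K^2\int_0^TW(s)^2\,ds+K\right).$$
   Context: A locally finite weighted graph $G=(V,E)$ here means a connected graph in which every vertex has finitely many neighbours, with a vertex measure $\mu:V\to(0,\infty)$ and symmetric edge weights $w_{xy}=w_{yx}>0$ for $x\sim y$ (adjacent), such that $D_\mu:=\sup_{x}\frac{\deg(x)}{\mu(x)}<\infty$ where $\deg(x)=\sum_{y\sim x}w_{xy}$, $\mu_{\max}:=\sup_x\mu(x)<\infty$, and $w_{\min}:=\inf_{x\sim y}w_{xy}>0$. For $f:V\to\mathbb R$, $\Delta f(x)=\frac1{\mu(x)}\sum_{y\sim x}w_{xy}(f(y)-f(x))$. $\Delta$ is bounded on $\ell^\infty(V)$ (bounded functions, sup norm), and $P_t=e^{t\Delta}=\sum_{k\ge0}\frac{t^k}{k!}\Delta^k$, $t\ge0$. For $\psi\in C^1(0,\infty)$ and $f:V\to(0,\infty)$: $(\Delta^\psi f)(x)=\Delta\left[\psi\left(\frac{f}{f(x)}\right)\right](x)$.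 For concave $\psi$ put $\overline\psi(s)=\psi'(1)(s-1)-[\psi(s)-\psi(1)]$ and $\Gamma^\psi(f):=\Delta^{\overline\psi}f$, i.e. $\Gamma^\psi(f)(x)=\frac1{\mu(x)}\sum_{y\sim x}w_{xy}\overline\psi\left(\frac{f(y)}{f(x)}\right)$. Further $$\Omega^\psi f(x)=\Delta\left[\psi'\left(\frac f{f(x)}\right)\frac f{f(x)}\left(\frac{\Delta f}{f}-\frac{\Delta f(x)}{f(x)}\right)\right](x),$$ $$2\Gamma_2^\psi(f)=\Omega^\psi(f)+\frac{\Delta f\cdot\Delta^\psi f}{f}-\frac{\Delta(f\cdot\Delta^\psi f)}{f}.$$ For $n>0$ and $\kappa\in\mathbb R$, $G$ satisfies $CD\psi(n,\kappa)$ if for every $f:V\to(0,\infty)$, pointwise on $V$, $\Gamma_2^\psi(f)\ge\frac1n(\Delta^\psi f)^2+\kappa\,\Gamma^\psi(f)$. *)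

(* Defs.v *)
From HB Require Import structures.
From mathcomp Require Import all_boot all_order all_algebra.
From mathcomp Require Import all_classical all_reals all_analysis.

Set Implicit Arguments.
Unset Strict Implicit.
Unset Printing Implicit Defensive.

Import Order.TTheory GRing.Theory Num.Theory.
Import numFieldNormedType.Exports.

Local Open Scope classical_set_scope.
Local Open Scope ring_scope.

(* Only the values of [weight] on adjacent pairs are ever used. *)
Record wgraph (R : realType) (V : choiceType) := WGraph {
  adj : rel V ;
  vmeas : V -> R ;
  weight : V -> V -> R }.

Section WeightedGraph.
Context {R : realType} {V : choiceType}.
Implicit Types (G : wgraph R V) (f : V -> R) (psi : R -> R) (x y : V).

Definition nbrs G x : set V := [set y | adj G x y].

(* [\sum_(y \in A)] is a finite sum, and is meaningful here because [nbrs G x]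
   is finite in a locally finite graph. *)
Definition deg G x : R := \sum_(y \in nbrs G x) weight G x y.

Definition D_mu G : \bar R := ereal_sup (range (fun x => (deg G x / vmeas G x)%:E)).

Definition mu_max G : \bar R := ereal_sup (range (fun x => (vmeas G x)%:E)).

Definition w_min G : \bar R :=
  ereal_inf [set (weight G e.1 e.2)%:E | e in [set e | adj G e.1 e.2]].

Definition connected_graph G : Prop :=
  forall x y, exists2 p : seq V, path (adj G) x p & y = last x p.

Record locally_finite_weighted_graph G : Prop := {
  adj_sym : symmetric (adj G) ;
  adj_irrefl : irreflexive (adj G) ;
  adj_connected : connected_graph G ;
  nbrs_finite : forall x, finite_set (nbrs G x) ;
  vmeas_gt0 : forall x, 0 < vmeas G x ;
  weight_sym : forall x y, adj G x y -> weight G x y = weight G y x ;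
  weight_gt0 : forall x y, adj G x y -> 0 < weight G x y ;
  D_mu_lty : (D_mu G < +oo)%E ;
  mu_max_lty : (mu_max G < +oo)%E ;
  w_min_gt0 : (0 < w_min G)%E }.

Definition laplacian G f : V -> R :=
  fun x => (vmeas G x)^-1 * \sum_(y \in nbrs G x) weight G x y * (f y - f x).

(* The exponential series of [t] times the Laplacian, evaluated at each vertex.
   For bounded [f] it converges in the sup norm, the Laplacian being bounded
   on bounded functions when [D_mu G] is finite; so this pointwise limit is the
   value at [x] of the limit in l^infinity. *)
Definition heat G (t : R) f : V -> R :=
  fun x => limn (series (fun k => t ^+ k / k`!%:R * iter k (laplacian G) f x)).

Definition lap_psi G psi f : V -> R :=
  fun x => laplacian G (fun y => psi (f y / f x)) x.

Definition psi_bar psi : R -> R :=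
  fun s => derive1 psi 1 * (s - 1) - (psi s - psi 1).

Definition Gamma_psi G psi f : V -> R := lap_psi G (psi_bar psi) f.

Definition Omega_psi G psi f : V -> R :=
  fun x => laplacian G
    (fun y => derive1 psi (f y / f x) * (f y / f x) *
              (laplacian G f y / f y - laplacian G f x / f x)) x.

Definition Gamma2_psi G psi f : V -> R :=
  fun x => (Omega_psi G psi f x
            + laplacian G f x * lap_psi G psi f x / f x
            - laplacian G (fun y => f y * lap_psi G psi f y) x / f x) / 2.

Definition CD_psi G psi (n kappa : R) : Prop :=
  forall f, (forall x, 0 < f x) ->
  forall x, n^-1 * (lap_psi G psi f x) ^+ 2 + kappa * Gamma_psi G psi f x
            <= Gamma2_psi G psi f x.

End WeightedGraph.

Section RealFunctions.
Context {R : realType}.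
Implicit Types (psi W : R -> R) (a b : R).

Definition C1_pos psi : Prop :=
  {in `]0, +oo[, forall s, derivable psi s 1} /\
  {in `]0, +oo[, continuous (derive1 psi)}.

Definition concave_pos psi : Prop :=
  convex_function (`]0, +oo[%classic : set R^o) (fun s : R^o => - psi s).

(* C^1 on [a, b[, the derivative at the left endpoint being the right one. *)
Definition C1_itvco W a b : Prop :=
  [/\ {in `]a, b[, forall t, derivable W t 1},
      {in `]a, b[, continuous (derive1 W)} &
      exists2 d : R,
        (W t - W a) / (t - a) @[t --> a^'+] --> d &
        derive1 W t @[t --> a^'+] --> d].

(* [g] restricted to ]a, b[ is in L^2(]a, b[), via its extension by zero. *)
Definition L2_itvoo (g : R -> R) a b : Prop :=
  (g \_ `]a, b[) \in Lfun (@lebesgue_measure R) 2%:E.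

End RealFunctions.

(* Main.v *)
Require Import Defs.
From HB Require Import structures.
From mathcomp Require Import all_boot all_order all_algebra.
From mathcomp Require Import all_classical all_reals all_analysis.
From mathcomp Require Import finmap ring lra.

Set Implicit Arguments.
Unset Strict Implicit.
Unset Printing Implicit Defensive.

Import Order.TTheory GRing.Theory Num.Theory.
Import numFieldNormedType.Exports.

Local Open Scope classical_set_scope.
Local Open Scope ring_scope.

(* The classical argument differentiates s |-> W(s)^2 P_s(u Gamma(u)) with
   u = P_(T-s) f.  Here the semigroup P_s is replaced by a maximum principle.
   Let u_t = P_t f, w(t) = W(T - t), c = psi'(1), so that
   u Gamma(u) = c Lap u - u Lap^psi u, and put
     Z_t = w^2 (c Lap u_t - u_t Lap^psi u_t) - alpha Lap u_t - beta u_t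
   with alpha' = 2 c w (w' + K w), beta' = n/2 (w' + K w)^2 and
   alpha(0) = beta(0) = 0.  Since
     d/dt (u Gamma(u)) = Lap (u Gamma(u)) - 2 u Gamma_2(u),
   the curvature condition gives
     dZ/dt - Lap Z <= - 2/n u (w Lap^psi u + n/2 (w' + K w))^2 <= 0,
   hence Z_T <= 0, which is the claim divided by u_T.  Boundedness of Z needs
   f bounded away from 0; in general, apply this to f + e, use
   P_T (f + e) = P_T f + e, and let e tend to 0. *)

Lemma derive_le0_le {R : realType} (F dF : R -> R) (a b : R) :
  {within `[a, b], continuous F} ->
  (forall t, t \in `]a, b[ -> is_derive t 1 F (dF t)) ->
  (forall t, t \in `]a, b[ -> dF t <= 0) ->
  forall t, t \in `[a, b] -> F t <= F a.
Proof.
move=> cF hF dF0 t tab.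
apply: (@ler0_derive1_le_cc _ F a b) => //.
- by move=> s sab; have [] := hF s sab.
- by move=> s sab; rewrite derive1E (@derive_val _ _ _ _ _ _ _ (hF s sab)) dF0.
- by move: tab; rewrite !in_itv /= lexx /= => /andP[/le_trans + ]; apply.
- by move: tab; rewrite in_itv /= => /andP[].
Qed.

Lemma is_derive_sum_seq {R : numFieldType} {U W : normedModType R}
    (I : Type) (r : seq I) (h : I -> U -> W) (dh : I -> W) (x v : U) :
  (forall i, is_derive x v (h i) (dh i)) ->
  is_derive x v (fun t => \sum_(i <- r) h i t) (\sum_(i <- r) dh i).
Proof.
move=> hd; elim: r => [|i r ih].
  rewrite big_nil (_ : (fun _ => _) = cst 0); first exact: is_derive_cst.
  by apply/funext => t; rewrite big_nil.
rewrite big_cons (_ : (fun _ => _) = h i + (fun t => \sum_(j <- r) h j t)).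
  exact: is_deriveD.
by apply/funext => t; rewrite big_cons.
Qed.

Lemma is_derive_within_continuous {R : realType} (f df : R -> R) (i : interval R) :
  (forall t : R, is_derive t 1 f (df t)) -> {within [set` i], continuous f}.
Proof. by move=> hf; apply: derivable_within_continuous => t _; case: (hf t). Qed.

Section within_continuous.
Context {R : realType} (A : set R).
Implicit Types f g : R -> R.

Lemma within_continuousD f g : {within A, continuous f} ->
  {within A, continuous g} -> {within A, continuous (fun t => f t + g t)}.
Proof. by move=> cf cg t; exact: cvgD (cf t) (cg t). Qed.

Lemma within_continuousB f g : {within A, continuous f} ->
  {within A, continuous g} -> {within A, continuous (fun t => f t - g t)}.
Proof. by move=> cf cg t; exact: cvgB (cf t) (cg t). Qed.

Lemma within_continuousM f g : {within A, continuous f} ->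
  {within A, continuous g} -> {within A, continuous (fun t => f t * g t)}.
Proof. by move=> cf cg t; exact: cvgM (cf t) (cg t). Qed.

End within_continuous.

Lemma is_derive_expRM {R : realType} (c t : R) :
  is_derive t 1 (fun s => expR (c * s)) (c * expR (c * t)).
Proof.
have h := is_deriveZ c (is_derive_id t (1 : R)).
have := is_derive1_comp (is_derive_expR (c *: t)) h.
by rewrite /GRing.scale /= mulr1 mulrC.
Qed.

Section Laplacian.
Context {R : realType} {V : choiceType} (G : wgraph R V).
Hypothesis hG : locally_finite_weighted_graph G.

Definition max_deg : R := fine (D_mu G).

Lemma laplacianE f x : laplacian G f x =
  \sum_(y <- fset_set (nbrs G x)) weight G x y / vmeas G x * (f y - f x).
Proof.
rewrite /laplacian fsbig_finite; last exact: (nbrs_finite hG).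
by rewrite mulr_sumr; apply: eq_bigr => y _; rewrite mulrA (mulrC _^-1).
Qed.

Lemma rate_ge0 x y : y \in fset_set (nbrs G x) -> 0 <= weight G x y / vmeas G x.
Proof.
rewrite in_fset_set; last exact: (nbrs_finite hG).
move/set_mem => xy.
by rewrite divr_ge0// ltW// ?(vmeas_gt0 hG)// (weight_gt0 hG).
Qed.

Lemma total_rate_le x :
  \sum_(y <- fset_set (nbrs G x)) weight G x y / vmeas G x <= max_deg.
Proof.
rewrite -mulr_suml -fsbig_finite; last exact: (nbrs_finite hG).
rewrite -/(deg G x) /max_deg -lee_fin.
have le : ((deg G x / vmeas G x)%:E <= D_mu G)%E.
  by apply: ereal_sup_ubound; exists x.
rewrite fineK// fin_numE (lt_eqF (D_mu_lty hG)) andbT.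
by rewrite gt_eqF// (lt_le_trans _ le)// ltNyr.
Qed.

Lemma max_deg_ge0 (x : V) : 0 <= max_deg.
Proof.
apply: le_trans (total_rate_le x).
by rewrite big_seq sumr_ge0// => y; exact: rate_ge0.
Qed.

Lemma laplacian_le f x B : (forall y, f y <= B) ->
  laplacian G f x <= max_deg * (B - f x).
Proof.
move=> fB; rewrite laplacianE.
apply: (@le_trans _ _
    ((\sum_(y <- fset_set (nbrs G x)) weight G x y / vmeas G x) * (B - f x))).
  rewrite mulr_suml !big_seq ler_sum// => y yx.
  by rewrite ler_wpM2l ?rate_ge0// lerB.
by rewrite ler_wpM2r ?subr_ge0// total_rate_le.
Qed.

Lemma laplacianD f g x :
  laplacian G (fun y => f y + g y) x = laplacian G f x + laplacian G g x.
Proof.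
rewrite !laplacianE -big_split /=; apply: eq_bigr => y _.
by rewrite -mulrDr; congr (_ * _); ring.
Qed.

Lemma laplacianZ a f x :
  laplacian G (fun y => a * f y) x = a * laplacian G f x.
Proof.
rewrite !laplacianE mulr_sumr; apply: eq_bigr => y _.
by rewrite -mulrBr mulrCA.
Qed.

Lemma laplacianN f x : laplacian G (fun y => - f y) x = - laplacian G f x.
Proof.
by rewrite -mulN1r -laplacianZ; congr laplacian; apply/funext => y; rewrite mulN1r.
Qed.

Lemma laplacianB f g x :
  laplacian G (fun y => f y - g y) x = laplacian G f x - laplacian G g x.
Proof. by rewrite laplacianD laplacianN. Qed.

Lemma laplacian_cst a x : laplacian G (fun=> a) x = 0.
Proof. by rewrite laplacianE big1// => y _; rewrite subrr mulr0. Qed.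

Lemma laplacian_norm_le f x M : (forall y, `|f y| <= M) ->
  `|laplacian G f x| <= 2 * max_deg * M.
Proof.
move=> fM.
have Dfx (a : R) : `|a| <= M -> max_deg * (M - a) <= 2 * max_deg * M.
  rewrite ler_norml => /andP[Ma _].
  rewrite (mulrC 2) -mulrA ler_wpM2l ?(max_deg_ge0 x)//; lra.
rewrite ler_norml lerNl; apply/andP; split.
- rewrite -laplacianN (le_trans (@laplacian_le _ _ M _))//.
    by move=> y; rewrite (le_trans (ler_norm _))// normrN.
  by rewrite Dfx// normrN.
- rewrite (le_trans (@laplacian_le _ _ M _))//.
    by move=> y; rewrite (le_trans (ler_norm _)).
  by rewrite Dfx.
Qed.

Lemma is_derive_laplacian (u : R -> V -> R) (du : V -> R) (t : R) x :
  (forall y, is_derive t 1 (u ^~ y) (du y)) ->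
  is_derive t 1 (fun s => laplacian G (u s) x) (laplacian G du x).
Proof.
move=> hu; rewrite laplacianE.
rewrite (_ : (fun s => _) = fun s => \sum_(y <- fset_set (nbrs G x))
    weight G x y / vmeas G x * (u s y - u s x)); last first.
  by apply/funext => s; rewrite laplacianE.
exact: is_derive_sum_seq.
Qed.

Lemma cvg_laplacian {T : Type} (F : set_system T) {FF : Filter F}
    (u : T -> V -> R) (l : V -> R) x :
  (forall y, u t y @[t --> F] --> l y) ->
  laplacian G (u t) x @[t --> F] --> laplacian G l x.
Proof.
move=> hu; rewrite laplacianE.
rewrite (_ : (fun t => _) = fun t => \sum_(y <- fset_set (nbrs G x))
    weight G x y / vmeas G x * (u t y - u t x)); last first.
  by apply/funext => t; rewrite laplacianE.
apply: cvg_big => [|y _].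
  exact: add_continuous.
exact: cvgM (cvg_cst _) (cvgB (hu y) (hu x)).
Qed.

(* The weight [expR (D * t)] turns [dZ <= Lap Z] into an inequality with the
   positivity preserving operator [Lap + D]; a bound [b t ^+ N] for the positive
   part then improves to [D * b * t ^+ N.+1 / N.+1], which tends to zero. *)
Lemma maximum_principle (Z dZ : R -> V -> R) (T M : R) :
  (forall y, {within `[0, T], continuous (Z ^~ y)}) ->
  (forall (t : R) y, t \in `]0, T[ -> is_derive t 1 (Z ^~ y) (dZ t y)) ->
  (forall (t : R) y, t \in `]0, T[ -> dZ t y <= laplacian G (Z t) y) ->
  (forall (t : R) y, t \in `[0, T] -> Z t y <= M) ->
  (forall y, Z 0 y <= 0) ->
  forall (t : R) y, t \in `[0, T] -> Z t y <= 0.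
Proof.
move=> cZ hZ dZ_le Z_M Z0 t y tT.
set D := max_deg; have D0 : 0 <= D := max_deg_ge0 y.
pose B := expR (D * T) * `|M|.
have bound N (s : R) z : s \in `[0, T] -> expR (D * s) * Z s z <= B * exp_coeff (D * s) N.
  elim: N s z => [|N ih] s z sT.
    rewrite /exp_coeff /= expr0 fact0 divr1 mulr1 /B.
    apply: (@le_trans _ _ (expR (D * s) * `|M|)).
      by rewrite ler_wpM2l ?expR_ge0// (le_trans (Z_M _ _ sT)) ?ler_norm.
    rewrite ler_wpM2r// ler_expR ler_wpM2l//.
    by move: sT; rewrite in_itv /= => /andP[].
  have dX (r : R) : is_derive r 1 (fun s => B * exp_coeff (D * s) N.+1)
      (D * B * exp_coeff (D * r) N).
    have e1 : (fun s => B * exp_coeff (D * s) N.+1) =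
        (B * D ^+ N.+1 / N.+1`!%:R) *: (id ^+ N.+1).
      apply/funext => s'; rewrite /exp_coeff /= exprMn.
      by rewrite !fctE /GRing.scale /=; ring.
    rewrite e1; apply: is_derive_eq.
    rewrite /exp_coeff /= /GRing.scale /= factS natrM exprMn !exprS; field.
    by rewrite !nat1r !pnatr_eq0 -lt0n fact_gt0.
  pose F s := expR (D * s) * Z s z - B * exp_coeff (D * s) N.+1.
  suff : F s <= F 0.
    rewrite {2}/F mulr0 expR0 mul1r /exp_coeff /= expr0n /= mul0r mulr0 subr0.
    by move=> /le_trans/(_ (Z0 z)); rewrite subr_le0.
  apply: (@derive_le0_le _ F (fun r => (expR (D * r) * dZ r z +
     Z r z * (D * expR (D * r))) - D * B * exp_coeff (D * r) N) 0 T) => //.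
  - apply: within_continuousB.
      by apply: within_continuousM => //; exact: is_derive_within_continuous.
    exact: is_derive_within_continuous.
  - move=> r rT; have hz := hZ r z rT.
    exact: (is_deriveB (is_deriveM (is_derive_expRM D r) hz) (dX r)).
  - move=> r rT.
    have rT' : r \in `[0, T] by apply: subset_itv_oo_cc.
    set b := expR (- (D * r)) * (B * exp_coeff (D * r) N).
    have Zb w : Z r w <= b.
      by rewrite /b -ler_pdivrMl ?expR_gt0// -expRN opprK ih.
    have := le_trans (dZ_le r z rT) (laplacian_le z Zb).
    rewrite -/D => h.
    have : expR (D * r) * dZ r z <= expR (D * r) * (D * (b - Z r z)).
      by rewrite ler_wpM2l ?expR_ge0.
    have -> : expR (D * r) * (D * (b - Z r z)) =
        D * (expR (D * r) * b) - Z r z * (D * expR (D * r)) by ring.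
    rewrite /b (mulrA (expR (D * r))) -expRD subrr expR0 mul1r mulrA; lra.
have : expR (D * t) * Z t y <= 0.
  have cv : B * exp_coeff (D * t) n @[n --> \oo] --> B * 0.
    apply: cvgM (cvg_cst _) _; exact: cvg_exp_coeff.
  rewrite -(mulr0 B) -(cvg_lim _ cv)//; apply: limr_ge; first exact: cvgP cv.
  by near=> n; exact: bound.
by rewrite pmulr_rle0 ?expR_gt0.
Unshelve. all: by end_near. Qed.

End Laplacian.

Section Heat.
Context {R : realType} {V : choiceType} (G : wgraph R V).
Hypothesis hG : locally_finite_weighted_graph G.
Implicit Types f : V -> R.

Definition heat_coeff f x k : R := k`!%:R^-1 * iter k (laplacian G) f x.

Lemma iter_laplacian_norm_le f M k x : (forall y, `|f y| <= M) ->
  `|iter k (laplacian G) f x| <= (2 * max_deg G) ^+ k * M.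
Proof.
move=> fM; elim: k x => [|k ih] x; first by rewrite expr0 mul1r /=; exact: fM.
by rewrite iterS exprS -mulrA; exact: laplacian_norm_le.
Qed.

Lemma heat_pseries t f x : heat G t f x = limn (pseries (heat_coeff f x) t).
Proof.
rewrite /heat /pseries.
suff -> : (fun k => t ^+ k / k`!%:R * iter k (laplacian G) f x) =
  (fun k => heat_coeff f x k * t ^+ k) by [].
by apply/funext => k; rewrite mulrC mulrA mulrAC (mulrC (iter _ _ _ _)).
Qed.

Lemma heat_coeff_norm_le f M t x k : (forall y, `|f y| <= M) ->
  `|heat_coeff f x k * t ^+ k| <= M * exp_coeff (2 * max_deg G * `|t|) k.
Proof.
move=> fM; rewrite /heat_coeff /exp_coeff /= !normrM normfV normr_nat normrX.
have -> : M * ((2 * max_deg G * `|t|) ^+ k / k`!%:R) =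
    k`!%:R^-1 * ((2 * max_deg G) ^+ k * M) * `|t| ^+ k by rewrite exprMn; ring.
by rewrite ler_wpM2r ?exprn_ge0// ler_wpM2l ?invr_ge0// iter_laplacian_norm_le.
Qed.

Lemma is_cvg_heat f M t x : (forall y, `|f y| <= M) ->
  cvgn (pseries (heat_coeff f x) t).
Proof.
move=> fM; apply: normed_cvg.
apply: (@series_le_cvg _ _ (fun k => M * exp_coeff (2 * max_deg G * `|t|) k)).
- by move=> k; exact: normr_ge0.
- by move=> k; rewrite (le_trans _ (heat_coeff_norm_le t x k fM)).
- by move=> k; exact: heat_coeff_norm_le.
- exact: is_cvg_seriesZ (is_cvg_series_exp_coeff _).
Qed.

Lemma heat_norm_le f M t x : (forall y, `|f y| <= M) ->
  `|heat G t f x| <= M * expR (2 * max_deg G * `|t|).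
Proof.
move=> fM; rewrite heat_pseries.
have cE := is_cvg_series_exp_coeff (2 * max_deg G * `|t|).
have cN : cvgn [normed pseries (heat_coeff f x) t].
  apply: (series_le_cvg _ _ (heat_coeff_norm_le t x ^~ fM)) => [k|k|].
  - exact: normr_ge0.
  - by rewrite (le_trans _ (heat_coeff_norm_le t x k fM)).
  - exact: is_cvg_seriesZ cE.
rewrite (le_trans (lim_series_norm cN))// /expR -[M * _](lim_seriesZ _ cE).
apply: lim_series_le => //; first exact: is_cvg_seriesZ.
by move=> k; exact: heat_coeff_norm_le.
Qed.

Lemma pseries_diffs_heat_coeff f x :
  pseries_diffs (heat_coeff f x) = heat_coeff (laplacian G f) x.
Proof.
apply/funext => k; rewrite /pseries_diffs /heat_coeff iterSr factS natrM.
by rewrite invfM !mulrA mulfV ?mul1r// pnatr_eq0.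
Qed.

Lemma heat_laplacian f M t x : (forall y, `|f y| <= M) ->
  heat G t (laplacian G f) x = laplacian G (heat G t f) x.
Proof.
move=> fM; rewrite heat_pseries.
have cv : laplacian G (fun y => pseries (heat_coeff f y) t n) x @[n --> \oo] -->
    laplacian G (heat G t f) x.
  apply: (cvg_laplacian hG) => y.
  by rewrite heat_pseries; exact: is_cvg_heat fM.
apply/cvg_lim => //; apply: cvg_trans cv; apply: near_eq_cvg.
apply: nearW => n; rewrite /pseries /series /=.
elim: n => [|n ih].
  under [in LHS]eq_fun do rewrite big_nil.
  by rewrite big_nil laplacian_cst.
under [in LHS]eq_fun do rewrite big_nat_recr//=.
rewrite big_nat_recr//= laplacianD// -ih; congr +%R.
under eq_fun do rewrite mulrC.
rewrite laplacianZ// /heat_coeff laplacianZ// -iterS iterSr; ring.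
Qed.

Lemma is_derive_heat f M (t : R) x : (forall y, `|f y| <= M) ->
  is_derive t 1 (fun s => heat G s f x) (laplacian G (heat G t f) x).
Proof.
move=> fM.
have dM y : `|laplacian G f y| <= 2 * max_deg G * M.
  exact: laplacian_norm_le.
have ddM y : `|laplacian G (laplacian G f) y| <= 2 * max_deg G * (2 * max_deg G * M).
  exact: laplacian_norm_le.
rewrite -(heat_laplacian _ _ fM) heat_pseries.
rewrite (_ : (fun s => _) = fun s => limn (pseries (heat_coeff f x) s)); last first.
  by apply/funext => s; rewrite heat_pseries.
rewrite -pseries_diffs_heat_coeff.
apply: (@pseries_snd_diffs _ _ (`|t| + 1)).
- exact: is_cvg_heat fM.
- by rewrite pseries_diffs_heat_coeff; exact: is_cvg_heat dM.
- by rewrite !pseries_diffs_heat_coeff; exact: is_cvg_heat ddM.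
- by rewrite (ger0_norm (_ : 0 <= `|t| + 1)) ?ltrDl ?addr_ge0.
Qed.

Lemma heat0 f x : heat G 0 f x = f x.
Proof.
rewrite /heat; apply/cvg_lim => //.
apply: (@cvg_trans _ (f x @[n --> \oo])); last exact: cvg_cst.
apply: near_eq_cvg; near=> n.
have n0 : (0 < n)%N by near: n; exists 1%N.
rewrite /series /= big_ltn// expr0 fact0 divr1 mul1r big_nat big1 ?addr0//.
by move=> k /andP[k0 _]; rewrite expr0n (gtn_eqF k0) /= !mul0r.
Unshelve. all: by end_near. Qed.

End Heat.

Section HeatOrder.
Context {R : realType} {V : choiceType} (G : wgraph R V).
Hypothesis hG : locally_finite_weighted_graph G.
Implicit Types f g : V -> R.

Lemma heat_cst0 (t : R) x : heat G t (fun=> 0) x = 0.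
Proof.
apply/eqP; rewrite -normr_le0.
have := @heat_norm_le _ _ _ hG (fun=> 0) 0 t x.
by rewrite mul0r; apply => y; rewrite normr0.
Qed.

Lemma heat_comparison f g M a (t : R) x :
  (forall y, `|f y| <= M) -> (forall y, `|g y| <= M) ->
  (forall y, f y <= g y + a) -> 0 <= t -> heat G t f x <= heat G t g x + a.
Proof.
move=> fM gM fg t0.
pose Z s y := heat G s f y - heat G s g y - a.
have hZ (s : R) y : is_derive s 1 (Z ^~ y) (laplacian G (Z s) y).
  have df := is_derive_heat hG s y fM; have dg := is_derive_heat hG s y gM.
  have -> : laplacian G (Z s) y =
      laplacian G (heat G s f) y - laplacian G (heat G s g) y - 0.
    by rewrite /Z !laplacianB// laplacian_cst.
  exact: (is_deriveB (is_deriveB df dg) (is_derive_cst a s 1)).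
suff : Z t x <= 0 by rewrite /Z; lra.
pose D := max_deg G.
apply: (@maximum_principle _ _ _ hG Z (fun s => laplacian G (Z s)) t
  (2 * (M * expR (2 * D * t)) + `|a|)) => //.
- by move=> y; exact: is_derive_within_continuous.
- move=> s y; rewrite in_itv /= => /andP[s0 st].
  have bd h : (forall y, `|h y| <= M) -> `|heat G s h y| <= M * expR (2 * D * t).
    move=> hM; apply: (le_trans (heat_norm_le hG s y hM)).
    rewrite ler_wpM2l ?(le_trans _ (hM y))// ler_expR ler_wpM2l ?ger0_norm//.
    by rewrite mulr_ge0// (max_deg_ge0 hG y).
  have := bd f fM; have := bd g gM; rewrite /Z !ler_norml.
  have := ler_norm (- a); rewrite normrN.
  move=> ? /andP[? ?] /andP[? ?]; lra.
- by move=> y; rewrite /Z !heat0; have := fg y; lra.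
- by rewrite in_itv /= t0 lexx.
Qed.

Lemma heat_le f M B (t : R) x : (forall y, `|f y| <= M) ->
  (forall y, f y <= B) -> 0 <= t -> heat G t f x <= B.
Proof.
move=> fM fB t0; rewrite -[B]add0r -(heat_cst0 t x).
apply: (@heat_comparison _ _ M) => // y; last by rewrite add0r.
by rewrite normr0 (le_trans _ (fM y)).
Qed.

Lemma heat_ge f M B (t : R) x : (forall y, `|f y| <= M) ->
  (forall y, B <= f y) -> 0 <= t -> B <= heat G t f x.
Proof.
move=> fM fB t0; rewrite -subr_ge0 -(heat_cst0 t x).
apply: (@heat_comparison _ _ M) => // y; last by rewrite subr_ge0.
by rewrite normr0 (le_trans _ (fM y)).
Qed.

Lemma heatD_cst f M a (t : R) x : (forall y, `|f y| <= M) -> 0 <= t ->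
  heat G t (fun y => f y + a) x = heat G t f x + a.
Proof.
move=> fM t0.
have fM1 y : `|f y| <= M + `|a| by rewrite (le_trans (fM y))// lerDl.
have fM2 y : `|f y + a| <= M + `|a|.
  by rewrite (le_trans (ler_normD _ _))// lerD.
apply/eqP; rewrite eq_le; apply/andP; split.
  exact: heat_comparison fM2 fM1 _ _.
rewrite -lerBrDr.
by apply: heat_comparison fM1 fM2 _ _ => // y; rewrite addrK.
Qed.

Lemma heat_gt0 f M (t : R) x : (forall y, `|f y| <= M) ->
  (forall y, 0 < f y) -> 0 <= t -> 0 < heat G t f x.
Proof.
move=> fM f0 t0; set D := max_deg G.
suff : - (expR (D * t) * heat G t f x) <= - f x.
  rewrite lerN2 => /(lt_le_trans (f0 x)).
  by rewrite pmulr_rgt0 ?expR_gt0.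
pose F s := - (expR (D * s) * heat G s f x).
have -> : - f x = F 0 by rewrite /F mulr0 expR0 mul1r heat0.
have hF (s : R) : is_derive s 1 F
    (- (expR (D * s) * laplacian G (heat G s f) x +
        heat G s f x * (D * expR (D * s)))).
  have du := is_derive_heat hG s x fM.
  exact: is_deriveN (is_deriveM (is_derive_expRM D s) du).
apply: (derive_le0_le (a := 0) (b := t) _ (fun s _ => hF s)).
- exact: is_derive_within_continuous.
- move=> s; rewrite in_itv /= => /andP[s0 _].
  have := @laplacian_le _ _ _ hG (fun y => - heat G s f y) x 0.
  rewrite laplacianN// opprK add0r -/D => h.
  have : - laplacian G (heat G s f) x <= D * heat G s f x.
    apply: h => y; rewrite oppr_le0.
    by apply: heat_ge fM _ (ltW s0) => z; rewrite ltW.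
  move/(ler_wpM2l (expR_ge0 (D * s))) => ?; lra.
- by rewrite in_itv /= t0 lexx.
Qed.

End HeatOrder.

Section PsiLaplacian.
Context {R : realType} {V : choiceType} (G : wgraph R V).
Hypothesis hG : locally_finite_weighted_graph G.
Variable psi : R -> R.
Hypothesis psi_C1 : C1_pos psi.

Lemma Gamma_psiE (u : V -> R) x : u x != 0 ->
  Gamma_psi G psi u x = derive1 psi 1 * (laplacian G u x / u x) - lap_psi G psi u x.
Proof.
move=> u0; rewrite /Gamma_psi /lap_psi /psi_bar laplacianB// laplacianZ// !laplacianB//.
rewrite !laplacian_cst// !subr0; congr (_ * _ - _).
under eq_fun do rewrite mulrC.
by rewrite laplacianZ// mulrC.
Qed.

Lemma is_derive_lap_psi (u du : R -> V -> R) (t : R) x :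
  (forall y, is_derive t 1 (u ^~ y) (du t y)) -> (forall y, 0 < u t y) ->
  du t = laplacian G (u t) ->
  is_derive t 1 (fun s => lap_psi G psi (u s) x) (Omega_psi G psi (u t) x).
Proof.
move=> hu u0 duE; rewrite /lap_psi /Omega_psi; apply: is_derive_laplacian => // y.
have ux0 z : u t z != 0 by rewrite gt_eqF.
have hr : is_derive t 1 (fun s => u s y / u s x)
    (u t y / u t x * (laplacian G (u t) y / u t y - laplacian G (u t) x / u t x)).
  have hM := is_deriveM (hu y) (is_deriveV (ux0 x) (hu x)).
  apply: (@is_derive_eq _ _ _ _ _ _ _ _ hM).
  rewrite /GRing.scale /= duE; field.
  by rewrite !ux0.
have hpsi : is_derive (u t y / u t x) 1 psi (derive1 psi (u t y / u t x)).
  rewrite derive1E; apply/derivableP.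
  by apply: (proj1 psi_C1); rewrite in_itv /= andbT divr_gt0.
by have := @is_derive1_comp _ psi (fun s => u s y / u s x) t _ _ hpsi hr; rewrite mulrA.
Qed.

End PsiLaplacian.

Lemma within_continuous_norm_bounded {R : realType} (g : R -> R) (a b : R) :
  {within `[a, b], continuous g} ->
  exists C, forall t, t \in `[a, b] -> `|g t| <= C.
Proof.
move=> cg; have [ab|ba] := leP a b; last first.
  exists 0 => t; rewrite in_itv /= => /andP[at' tb].
  by have := lt_le_trans ba (le_trans at' tb); rewrite ltxx.
have [c _ hc] := EVT_max ab cg; have [d _ hd] := EVT_min ab cg.
exists (`|g c| + `|g d|) => t tab.
have := hc t tab; have := hd t tab.
have := ler_norm (g c); have := ler_norm (- g d); rewrite normrN.
have := normr_ge0 (g c); have := normr_ge0 (g d).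
rewrite ler_norml => *; apply/andP; split; lra.
Qed.

Section LiYau.
Context {R : realType} {V : choiceType} (G : wgraph R V).
Hypothesis hG : locally_finite_weighted_graph G.
Variables (psi : R -> R) (n K : R).
Hypothesis psi_C1 : C1_pos psi.
Hypothesis n_gt0 : 0 < n.
Hypothesis hCD : CD_psi G psi n (- K).

Variables (f : V -> R) (e M : R).
Hypothesis e_gt0 : 0 < e.
Hypothesis f_ge : forall x, e <= f x.
Hypothesis f_le : forall x, `|f x| <= M.

Let u (t : R) := heat G t f.
Let h (t : R) y := u t y * lap_psi G psi (u t) y.
Let c := derive1 psi 1.

Let u_bnd (t : R) y : 0 <= t -> e <= u t y <= M.
Proof.
move=> t0; rewrite (heat_ge hG _ f_le)//=.
by apply: heat_le f_le _ _ => // z; rewrite (le_trans (ler_norm _)).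
Qed.

Let u_gt0 (t : R) y : 0 <= t -> 0 < u t y.
Proof. by move=> /(u_bnd y)/andP[+ _]; exact: lt_le_trans. Qed.

Let du (t : R) y : is_derive t 1 (u ^~ y) (laplacian G (u t) y).
Proof. exact: is_derive_heat f_le. Qed.

Let ddu (t : R) y : is_derive t 1 (fun s => laplacian G (u s) y)
  (laplacian G (laplacian G (u t)) y).
Proof. by apply: is_derive_laplacian => // z; exact: du. Qed.

Let dh (t : R) y : 0 <= t -> is_derive t 1 (h ^~ y)
  (u t y * Omega_psi G psi (u t) y + lap_psi G psi (u t) y * laplacian G (u t) y).
Proof.
move=> t0.
have dL := @is_derive_lap_psi _ _ _ hG _ psi_C1 u (fun s => laplacian G (u s)) t y
  (du t) (fun z => u_gt0 z t0) erefl.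
exact: is_deriveM (du t y) dL.
Qed.

Let Gamma2E (t : R) y : 0 <= t -> 2 * u t y * Gamma2_psi G psi (u t) y =
  u t y * Omega_psi G psi (u t) y + lap_psi G psi (u t) y * laplacian G (u t) y
  - laplacian G (h t) y.
Proof.
move=> t0; rewrite /Gamma2_psi -/(h t); field.
by rewrite gt_eqF ?u_gt0.
Qed.

Let lap_psi_bounded (x : V) : exists C, forall (t : R) y, 0 <= t ->
  `|lap_psi G psi (u t) y| <= C.
Proof.
have M_gt0 : 0 < M.
  by rewrite (lt_le_trans e_gt0)// (le_trans (f_ge x))// (le_trans (ler_norm _)).
have cpsi : {within `[e / M, M / e], continuous psi}.
  apply: derivable_within_continuous => s; rewrite in_itv /= => /andP[s0 _].
  apply: (proj1 psi_C1); rewrite in_itv /= andbT.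
  by rewrite (lt_le_trans _ s0)// divr_gt0.
have [C hC] := within_continuous_norm_bounded cpsi.
exists (2 * max_deg G * C) => t y t0; apply: laplacian_norm_le => // z.
have /andP[ey yM] := u_bnd y t0; have /andP[ez zM] := u_bnd z t0.
have y0 := u_gt0 y t0; have z0 := u_gt0 z t0.
apply: hC; rewrite in_itv /= !ler_pM ?invr_ge0 ?lef_pV2 ?posrE//; exact: ltW.
Qed.

Lemma heat_Li_Yau (T : R) (w dw alpha beta : R -> R) : 0 <= T ->
  {within `[0, T], continuous w} ->
  {within `[0, T], continuous alpha} ->
  {within `[0, T], continuous beta} ->
  (forall t : R, t \in `]0, T[ -> is_derive t 1 w (dw t)) ->
  (forall t : R, t \in `]0, T[ ->
    is_derive t 1 alpha (2 * c * (w t * dw t + K * w t ^+ 2))) ->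
  (forall t : R, t \in `]0, T[ ->
    is_derive t 1 beta (n / 2 * (dw t + K * w t) ^+ 2)) ->
  w 0 = 0 -> alpha 0 = 0 -> beta 0 = 0 ->
  forall x, w T ^+ 2 * (c * laplacian G (u T) x - h T x) <=
    alpha T * laplacian G (u T) x + beta T * u T x.
Proof.
move=> T0 cw calpha cbeta hw halpha hbeta w0 alpha0 beta0 x.
pose Z t y := w t ^+ 2 * (c * laplacian G (u t) y - h t y)
  - alpha t * laplacian G (u t) y - beta t * u t y.
suff : Z T x <= 0 by rewrite /Z; lra.
pose L t y := laplacian G (u t) y.
pose H t y := u t y * Omega_psi G psi (u t) y + lap_psi G psi (u t) y * L t y.
pose dZ t y := w t ^+ 2 * (c * laplacian G (L t) y - H t y)
  + (c * L t y - h t y) * (2 * w t * dw t)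
  - (alpha t * laplacian G (L t) y
     + L t y * (2 * c * (w t * dw t + K * w t ^+ 2)))
  - (beta t * L t y + u t y * (n / 2 * (dw t + K * w t) ^+ 2)).
have [Cpsi hCpsi] := lap_psi_bounded x.
have [Bw hBw] := within_continuous_norm_bounded cw.
have [Ba hBa] := within_continuous_norm_bounded calpha.
have [Bb hBb] := within_continuous_norm_bounded cbeta.
have L_le (t : R) y : 0 <= t -> `|L t y| <= 2 * max_deg G * M.
  move=> t0; apply: laplacian_norm_le => // z.
  by have /andP[ez zM] := u_bnd z t0; rewrite ger0_norm// (le_trans (ltW e_gt0)).
apply: (@maximum_principle _ _ _ hG Z dZ T
  (Bw * Bw * (`|c| * (2 * max_deg G * M) + M * Cpsi)
   + Ba * (2 * max_deg G * M) + Bb * M)).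
- move=> y.
  have cu := is_derive_within_continuous (i := `[0, T]) (fun t => du t y).
  have cL := is_derive_within_continuous (i := `[0, T]) (fun t => ddu t y).
  have ch : {within `[0, T], continuous (h ^~ y)}.
    apply: derivable_within_continuous => t; rewrite in_itv /= => /andP[t0 _].
    by have [] := dh y t0.
  have cc : {within `[0, T], continuous (cst c : R -> R)}.
    exact: is_derive_within_continuous (fun t => is_derive_cst c t 1).
  apply: within_continuousB; last exact: within_continuousM.
  apply: within_continuousB; last exact: within_continuousM.
  apply: within_continuousM; first exact: (within_continuousM cw cw).
  apply: within_continuousB => //.
  exact: within_continuousM cc cL.
- move=> t y tT; have t0 : 0 <= t by move: tT; rewrite in_itv /= => /andP[/ltW].
  have hw2 : is_derive t 1 (fun s => w s ^+ 2) (2 * w t * dw t).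
    have hM := is_deriveM (hw t tT) (hw t tT).
    by apply: (@is_derive_eq _ _ _ _ _ _ _ _ hM); rewrite /GRing.scale /=; ring.
  have hcL := is_deriveZ c (ddu t y).
  have h1 := is_deriveM hw2 (is_deriveB hcL (dh y t0)).
  have h2 := is_deriveM (halpha t tT) (ddu t y).
  have h3 := is_deriveM (hbeta t tT) (du t y).
  exact: is_deriveB (is_deriveB h1 h2) h3.
- move=> t y tT; have t0 : 0 <= t by move: tT; rewrite in_itv /= => /andP[/ltW].
  rewrite /Z !laplacianB// !laplacianZ// laplacianB// laplacianZ//.
  rewrite -/(L t) -/(L t y).
  have CD := hCD (fun z => u_gt0 z t0) y.
  have uy0 := u_gt0 y t0.
  rewrite Gamma_psiE ?gt_eqF// -/c -/(L t y) in CD.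
  have G2 := Gamma2E y t0; rewrite -/(L t y) -/(H t y) in G2.
  rewrite -subr_le0.
  set a := lap_psi G psi (u t) y in CD G2 *.
  set Gam2 := Gamma2_psi G psi (u t) y in CD G2 *.
  have hE : h t y = u t y * a by [].
  have -> : dZ t y - (w t ^+ 2 * (c * laplacian G (L t) y - laplacian G (h t) y)
     - alpha t * laplacian G (L t) y - beta t * L t y) =
   - (2 * w t ^+ 2 * u t y * (Gam2 - (n^-1 * a ^+ 2 + - K * (c * (L t y / u t y) - a))))
   - 2 / n * u t y * (w t * a + n / 2 * (dw t + K * w t)) ^+ 2.
    rewrite (_ : 2 * w t ^+ 2 * u t y * _ = w t ^+ 2 * (2 * u t y * Gam2) -
     2 * w t ^+ 2 * u t y * (n^-1 * a ^+ 2 + - K * (c * (L t y / u t y) - a))); last by ring.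
    rewrite G2 /dZ hE; field.
    by rewrite !gt_eqF.
  rewrite -opprD oppr_le0; apply: addr_ge0.
    apply: mulr_ge0; last by rewrite subr_ge0.
    by rewrite mulr_ge0 ?(ltW uy0)// mulr_ge0 ?sqr_ge0.
  by apply: mulr_ge0 (sqr_ge0 _); rewrite mulr_ge0 ?divr_ge0// ltW.
- move=> t y tT; have t0 : 0 <= t by move: tT; rewrite in_itv /= => /andP[].
  have /andP[eu uM] := u_bnd y t0.
  have un : `|u t y| <= M by rewrite ger0_norm// (le_trans (ltW e_gt0)).
  apply: (le_trans (ler_norm _)).
  apply: (le_trans (ler_normB _ _)); rewrite lerD//; last first.
    by rewrite normrM ler_pM// hBb.
  apply: (le_trans (ler_normB _ _)); rewrite lerD//; last first.
    by rewrite normrM ler_pM// ?hBa// L_le.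
  rewrite normrM ler_pM//; first by rewrite normrX expr2 ler_pM// hBw.
  apply: (le_trans (ler_normB _ _)); rewrite lerD// normrM.
    by rewrite ler_wpM2l// L_le.
  by rewrite ler_pM// hCpsi.
- by move=> y; rewrite /Z w0 alpha0 beta0 expr2 !mul0r !subr0.
- by rewrite in_itv /= T0 lexx.
Qed.

End LiYau.

Lemma is_derive_reverse {R : realType} (T : R) (F : R -> R) (dF t : R) :
  is_derive (T - t) 1 F dF -> is_derive t 1 (fun s => F (T - s)) (- dF).
Proof.
move=> hF.
have h : is_derive t 1 (fun s => T - s) (- 1).
  by rewrite -[- 1]add0r; exact: (is_deriveB (is_derive_cst T t 1) (is_derive_id t (1 : R))).
by have := @is_derive1_comp _ F (fun s => T - s) t _ _ hF h; rewrite mulrN1.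
Qed.

Lemma within_continuous_reverse {R : realType} (T : R) (F : R -> R) :
  {within `[0, T], continuous F} ->
  {within `[0, T], continuous (fun s => F (T - s))}.
Proof.
move=> /subspace_continuousP cF; apply/subspace_continuousP => t tT.
have sT s : `[0, T]%classic s -> `[0, T]%classic (T - s).
  by rewrite /= !in_itv /= => /andP[? ?]; apply/andP; split; lra.
apply: cvg_comp (cF _ (sT _ tT)).
have cB : (T - s) @[s --> within `[0, T] (nbhs t)] --> T - t.
  by apply: cvgB (cvg_cst _) _; exact: cvg_within.
move=> A; rewrite /within /= => hA.
have := cB _ hA; rewrite /within /nbhs /=.
by apply: filterS => s hs ts; apply: hs => //; exact: sT.
Qed.

Section IntegralOfSquares.
Context {R : realType} (T : R) (W : R -> R).
Notation mu := (@lebesgue_measure R).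

Lemma is_derive_parameterized_integral (q : R -> R) (t : R) :
  mu.-integrable `[0, T] (EFin \o q) -> t \in `]0, T[ -> {for t, continuous q} ->
  is_derive t 1 (fun s => parameterized_integral mu 0 s q) (q t).
Proof.
rewrite in_itv /= => iq /andP[t0 tT] cq.
have [d1 d2] := continuous_FTC1_closed tT iq t0 cq.
by rewrite -d2 derive1E; exact/derivableP.
Qed.

Hypothesis W_C1 : C1_itvco W 0 T.
Hypothesis W_cont : {within `[0, T], continuous W}.
Hypothesis W_L2 : L2_itvoo (derive1 W) 0 T.

Let q (s : R) := (derive1 W \_ `]0, T[) s ^+ 2.

Lemma integrable_sqr_continuous : mu.-integrable `[0, T] (EFin \o (fun s => W s ^+ 2)).
Proof.
apply: continuous_compact_integrable; first exact: segment_compact.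
exact: (within_continuousM W_cont W_cont).
Qed.

Lemma is_derive_W (t : R) : t \in `]0, T[ -> is_derive t 1 W (derive1 W t).
Proof.
by move=> tT; rewrite derive1E; apply/derivableP; case: W_C1 => + _ _; apply.
Qed.

Lemma is_derive_int_sqr (t : R) : t \in `]0, T[ ->
  is_derive t 1 (fun s => parameterized_integral mu 0 s (fun r => W r ^+ 2)) (W t ^+ 2).
Proof.
move=> tT; apply: is_derive_parameterized_integral (tT) _.
  exact: integrable_sqr_continuous.
have cW : {for t, continuous W}.
  apply: differentiable_continuous; apply/derivable1_diffP.
  by case: (is_derive_W tT).
exact: (continuousM cW cW).
Qed.

Lemma integrable_sqr_derive : mu.-integrable `[0, T] (EFin \o q).
Proof. by apply: integrableS (Lfun2_integrable_sqr W_L2). Qed.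

Lemma is_derive_int_sqr_derive (t : R) : t \in `]0, T[ ->
  is_derive t 1 (fun s => parameterized_integral mu 0 s q) (derive1 W t ^+ 2).
Proof.
move=> tT.
have qE : q t = derive1 W t ^+ 2 by rewrite /q patchE mem_set.
rewrite -qE; apply: is_derive_parameterized_integral (tT) _.
  exact: integrable_sqr_derive.
suff : q s @[s --> t] --> derive1 W t ^+ 2 by rewrite -qE.
have cW : {for t, continuous (derive1 W)} by case: W_C1 => _ + _; apply.
apply: cvg_trans (continuousM cW cW); apply: near_eq_cvg.
near=> s; rewrite /q patchE mem_set//=.
near: s; exact: (near_in_itvoo tT).
Unshelve. all: by end_near. Qed.

Lemma parameterized_integral_sqr_derive :
  parameterized_integral mu 0 T q = \int[mu]_(s in `]0, T[) (derive1 W s ^+ 2).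
Proof.
have qE s : `]0, T[%classic s -> q s = derive1 W s ^+ 2.
  by move=> sT; rewrite /q patchE mem_set.
have iq : mu.-integrable `]0, T[ (EFin \o q).
  by apply: integrableS integrable_sqr_derive => //; exact: subset_itv_oo_cc.
have iq' : mu.-integrable `]0, T] (EFin \o q).
  by apply: integrableS integrable_sqr_derive => //; exact: subset_itv_oc_cc.
rewrite /parameterized_integral -Rintegral_itv_obnd_cbnd//.
rewrite -Rintegral_itv_bndo_bndc//.
by apply: eq_Rintegral => s /set_mem; exact: qE.
Qed.

End IntegralOfSquares.

Theorem theorem4p1 (R : realType) (V : choiceType) (G : wgraph R V)
    (hG : locally_finite_weighted_graph G)
    (psi : R -> R) (psi_C1 : C1_pos psi) (psi_concave : concave_pos psi)
    (n K : R) (n_gt0 : 0 < n) (K_ge0 : 0 <= K)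
    (hCD : CD_psi G psi n (- K))
    (T : R) (T_gt0 : 0 < T)
    (W : R -> R) (W_C1 : C1_itvco W 0 T)
    (W_cont : {within `[0, T], continuous W})
    (W0 : W 0 = 1) (WT : W T = 0)
    (W_gt0 : forall s, 0 <= s < T -> 0 < W s)
    (W_L2 : L2_itvoo (derive1 W) 0 T)
    (f : V -> R) (f_bounded : bounded_fun f) (f_gt0 : forall x, 0 < f x)
    (x : V) :
  Gamma_psi G psi (heat G T f) x <=
    derive1 psi 1 * (1 + 2 * K * \int[lebesgue_measure]_(s in `[0, T]) (W s ^+ 2))
      * (laplacian G (heat G T f) x / heat G T f x)
    + n / 2 * (\int[lebesgue_measure]_(s in `]0, T[) (derive1 W s ^+ 2)
               + K ^+ 2 * \int[lebesgue_measure]_(s in `[0, T]) (W s ^+ 2)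
               + K).
Proof.
have [M fM] : exists M, forall y, `|f y| <= M.
  have [M0 [_ hM]] := f_bounded.
  by exists (M0 + 1) => y; apply: (hM (M0 + 1)) => //; rewrite ltrDl.
set c := derive1 psi 1.
pose I s := parameterized_integral lebesgue_measure 0 s (fun r => W r ^+ 2).
pose J s := parameterized_integral lebesgue_measure 0 s
  (fun r => (derive1 W \_ `]0, T[) r ^+ 2).
rewrite -(parameterized_integral_sqr_derive W_L2) -/(J T) -/(I T).
pose w t := W (T - t); pose dw t := - derive1 W (T - t).
pose alpha t := c * (w t ^+ 2 + 2 * K * (I T - I (T - t))).
pose beta t := n / 2 * (J T - J (T - t) + K ^+ 2 * (I T - I (T - t)) + K * w t ^+ 2).
have T_ge0 := ltW T_gt0.
have cI : {within `[0, T], continuous I}.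
  exact: parameterized_integral_continuous T_ge0 (integrable_sqr_continuous W_cont).
have cJ : {within `[0, T], continuous J}.
  exact: parameterized_integral_continuous T_ge0 (integrable_sqr_derive W_L2).
have cw : {within `[0, T], continuous w} by exact: within_continuous_reverse.
have cw2 : {within `[0, T], continuous (fun t => w t ^+ 2)}.
  exact: (within_continuousM cw cw).
have cC (a : R) : {within `[0, T], continuous (cst a : R -> R)}.
  exact: is_derive_within_continuous (fun t => is_derive_cst a t 1).
have cIr : {within `[0, T], continuous (fun t => I T - I (T - t))}.
  exact: (within_continuousB (cC (I T)) (within_continuous_reverse cI)).
have cJr : {within `[0, T], continuous (fun t => J T - J (T - t))}.
  exact: (within_continuousB (cC (J T)) (within_continuous_reverse cJ)).
have calpha : {within `[0, T], continuous alpha}.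
  apply: within_continuousM (cC c) _.
  exact: (within_continuousD cw2 (within_continuousM (cC (2 * K)) cIr)).
have cbeta : {within `[0, T], continuous beta}.
  apply: within_continuousM (cC (n / 2)) _.
  apply: within_continuousD; last exact: (within_continuousM (cC K) cw2).
  exact: (within_continuousD cJr (within_continuousM (cC (K ^+ 2)) cIr)).
have Tt (t : R) : t \in `]0, T[ -> T - t \in `]0, T[.
  by rewrite !in_itv /= => /andP[? ?]; apply/andP; split; lra.
have hw (t : R) : t \in `]0, T[ -> is_derive t 1 w (dw t).
  by move=> /Tt/(is_derive_W W_C1)/is_derive_reverse.
have hw2 (t : R) : t \in `]0, T[ -> is_derive t 1 (fun s => w s ^+ 2) (2 * w t * dw t).
  move=> tT; have hM := is_deriveM (hw t tT) (hw t tT).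
  by apply: (@is_derive_eq _ _ _ _ _ _ _ _ hM); rewrite /GRing.scale /=; ring.
have hI (t : R) : t \in `]0, T[ ->
    is_derive t 1 (fun s => I T - I (T - s)) (w t ^+ 2).
  move=> /Tt/(is_derive_int_sqr W_C1 W_cont)/is_derive_reverse h.
  by rewrite -[w t ^+ 2]opprK -sub0r; exact: (is_deriveB (is_derive_cst (I T) t 1) h).
have hJ (t : R) : t \in `]0, T[ ->
    is_derive t 1 (fun s => J T - J (T - s)) (dw t ^+ 2).
  move=> /Tt/(is_derive_int_sqr_derive W_C1 W_L2)/is_derive_reverse h.
  rewrite sqrrN -[_ ^+ 2]opprK -sub0r.
  exact: (is_deriveB (is_derive_cst (J T) t 1) h).
have halpha (t : R) : t \in `]0, T[ ->
    is_derive t 1 alpha (2 * c * (w t * dw t + K * w t ^+ 2)).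
  move=> tT; have h2 := hw2 t tT; have hi := hI t tT.
  have h := is_deriveZ c (is_deriveD h2 (is_deriveZ (2 * K) hi)).
  by apply: (@is_derive_eq _ _ _ _ _ _ _ _ h); rewrite /GRing.scale /=; ring.
have hbeta (t : R) : t \in `]0, T[ ->
    is_derive t 1 beta (n / 2 * (dw t + K * w t) ^+ 2).
  move=> tT; have h2 := hw2 t tT; have hi := hI t tT; have hj := hJ t tT.
  have h := is_deriveZ (n / 2) (is_deriveD (is_deriveD hj (is_deriveZ (K ^+ 2) hi))
    (is_deriveZ K h2)).
  by apply: (@is_derive_eq _ _ _ _ _ _ _ _ h); rewrite /GRing.scale /=; ring.
have w0 : w 0 = 0 by rewrite /w subr0.
have alpha0 : alpha 0 = 0 by rewrite /alpha w0 subr0; ring.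
have beta0 : beta 0 = 0 by rewrite /beta w0 subr0; ring.
have I0 : I 0 = 0 by rewrite /I /parameterized_integral set_itv1 Rintegral_set1.
have J0 : J 0 = 0 by rewrite /J /parameterized_integral set_itv1 Rintegral_set1.
have wT : w T = 1 by rewrite /w subrr.
have alphaT : alpha T = c * (1 + 2 * K * I T).
  by rewrite /alpha wT subrr I0; ring.
have betaT : beta T = n / 2 * (J T + K ^+ 2 * I T + K).
  by rewrite /beta wT subrr I0 J0; ring.
rewrite -alphaT -betaT.
set u := heat G T f.
have u_gt0 y : 0 < u y by exact: (heat_gt0 hG y fM f_gt0 T_ge0).
have shifted e : 0 < e -> 0 <= alpha T * (laplacian G u x / (u x + e)) + beta T
    - (c * (laplacian G u x / (u x + e)) - lap_psi G psi (fun y => u y + e) x).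
  move=> e_gt0.
  have fe y : e <= f y + e by rewrite lerDr ltW.
  have feM y : `|f y + e| <= M + e.
    by rewrite (le_trans (ler_normD _ _))// (gtr0_norm e_gt0) lerD2r.
  have := heat_Li_Yau hG psi_C1 n_gt0 hCD e_gt0 fe feM T_ge0 cw calpha cbeta hw
    halpha hbeta w0 alpha0 beta0 x.
  have -> : heat G T (fun y => f y + e) = fun y => u y + e.
    by apply/funext => y; exact: (heatD_cst hG e y fM T_ge0).
  rewrite laplacianD// laplacian_cst// addr0 wT expr1n mul1r -/c.
  have ue : 0 < u x + e by rewrite addr_gt0.
  rewrite -subr_ge0 -(pmulr_lge0 _ (_ : 0 < (u x + e)^-1)) ?invr_gt0// => h.
  apply: (le_trans h); rewrite le_eqVlt; apply/orP; left; apply/eqP; field.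
  by rewrite gt_eqF.
rewrite Gamma_psiE// ?gt_eqF// -/c -subr_ge0.
have cve y : (u y + e) @[e --> 0^'+] --> u y.
  rewrite -[X in _ --> X]addr0; apply: cvgD (cvg_cst _) _.
  exact: cvg_at_right_filter.
have cvV : (u x + e)^-1 @[e --> 0^'+] --> (u x)^-1.
  by apply: cvgV (cve x); rewrite gt_eqF.
have cvL : laplacian G u x / (u x + e) @[e --> 0^'+] --> laplacian G u x / u x.
  exact: cvgM (cvg_cst _) cvV.
have cvpsi : lap_psi G psi (fun y => u y + e) x @[e --> 0^'+] --> lap_psi G psi u x.
  apply: (cvg_laplacian hG) => y.
  apply: (@continuous_cvg _ _ _ _ _ _ psi).
    apply: differentiable_continuous; apply/derivable1_diffP.
    by apply: (proj1 psi_C1); rewrite in_itv /= andbT divr_gt0.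
  exact: cvgM (cve y) cvV.
have cv : alpha T * (laplacian G u x / (u x + e)) + beta T
    - (c * (laplacian G u x / (u x + e)) - lap_psi G psi (fun y => u y + e) x)
    @[e --> 0^'+] --> alpha T * (laplacian G u x / u x) + beta T
    - (c * (laplacian G u x / u x) - lap_psi G psi u x).
  exact: (cvgB (cvgD (cvgM (cvg_cst _) cvL) (cvg_cst _))
    (cvgB (cvgM (cvg_cst _) cvL) cvpsi)).
rewrite -(cvg_lim _ cv)//; apply: limr_ge; first exact: cvgP cv.
by near=> e; apply: shifted; near: e; exact: nbhs_right_gt.
Unshelve. all: by end_near. Qed.
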